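(* Let $n\ge2$, $\alpha\ge0$, $\beta\in\mathbb{R}$. The equivariant generalized Landau-Lifshitz equation $$u_t=(\alpha P+\beta u\times)\left(u_{rr}+\frac{2n-1}{r}u_r+\frac{2n-2+u_3}{r^2}e_3\right)$$ for radial $u=u(r,t)\in\mathbb{S}^2$ is given in the stereographic coordinate $f=(u_1+iu_2)/(1+u_3)$ by $$f_t=(\alpha+i\beta)\left[f_{rr}-\frac{2\overline f f_r^2}{1+|f|^2}+\frac{2n-1}{r}f_r-\frac{2n-1}{r^2}f+\frac1{r^2}\frac{2|f|^2f}{1+|f|^2}\right].$$
   Context: $\mathbb{S}^2\subset\mathbb{R}^3$ is the unit sphere, $e_3=(0,0,1)$, $u=(u_1,u_2,u_3)$, $P$ is the orthogonal projection of $\mathbb{R}^3$ onto $T_u\mathbb{S}^2$, and $\times$ is the cross product. The stereographic projection $f=(u_1+iu_2)/(1+u_3)$ is defined where $u\ne -e_3$, sends the north pole $e_3$ to $0$, and has inverse $(u_1,u_2,u_3)=\frac1{1+|f|^2}(2\,\mathrm{Re} f,\,2\,\mathrm{Im} f,\,1-|f|^2)$. The assertion is that, for sufficiently regular $u$ avoiding $-e_3$, $u$ solves the first equation if and only if $f$ solves the second. *)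

(* Defs.v *)
From Stdlib Require Import Reals.
From Coquelicot Require Import Coquelicot.

Open Scope R_scope.

Definition R3 : NormedModule R_AbsRing :=
  prod_NormedModule R_AbsRing
    (prod_NormedModule R_AbsRing R_NormedModule R_NormedModule)
    R_NormedModule.

Definition vec (a b c : R) : R3 := (a, b, c).
Definition c1 (v : R3) : R := fst (fst v).
Definition c2 (v : R3) : R := snd (fst v).
Definition c3 (v : R3) : R := snd v.

Definition e3 : R3 := vec 0 0 1.

Definition dot (v w : R3) : R := c1 v * c1 w + c2 v * c2 w + c3 v * c3 w.

Definition cross (v w : R3) : R3 :=
  vec (c2 v * c3 w - c3 v * c2 w)
      (c3 v * c1 w - c1 v * c3 w)
      (c1 v * c2 w - c2 v * c1 w).

Definition on_sphere (v : R3) : Prop := dot v v = 1.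

(* For [u] on the unit sphere the tangent space at [u] is the orthogonal
   complement of [u], so this is the orthogonal projection onto it. *)
Definition tproj (u w : R3) : R3 := minus w (scal (dot u w) u).

Definition stereo (u : R3) : C :=
  ((RtoC (c1 u) + Ci * RtoC (c2 u)) / RtoC (1 + c3 u))%C.

(* Functions of the radius and the time take their arguments in this order:
   [w r t].  On [D], [wt], [wr] and [wrr] are the derivatives w_t, w_r and
   w_rr of [w], whose existence is part of the assertion. *)
Definition partials {V : NormedModule R_AbsRing} (D : R * R -> Prop)
    (w wt wr wrr : R -> R -> V) : Prop :=
  forall r t : R, D (r, t) ->
    is_derive (fun s : R => w r s) t (wt r t) /\
    is_derive (fun x : R => w x t) r (wr r t) /\
    is_derive (fun x : R => wr x t) r (wrr r t).

Definition regular {V : NormedModule R_AbsRing} (D : R * R -> Prop)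
    (w : R -> R -> V) : Prop :=
  exists wt wr wrr : R -> R -> V, partials D w wt wr wrr.

Definition solves_LL (n : nat) (alpha beta : R) (D : R * R -> Prop)
    (u : R -> R -> R3) : Prop :=
  exists ut ur urr : R -> R -> R3,
    partials D u ut ur urr /\
    forall r t : R, D (r, t) ->
      let F : R3 :=
        plus (plus (urr r t) (scal ((2 * INR n - 1) / r) (ur r t)))
             (scal ((2 * INR n - 2 + c3 (u r t)) / r ^ 2) e3) in
      ut r t = plus (scal alpha (tproj (u r t) F))
                    (scal beta (cross (u r t) F)).

(* [C] is taken as a normed space over the reals, since [f] depends on real
   variables. *)
Definition solves_stereo_LL (n : nat) (alpha beta : R) (D : R * R -> Prop)
    (f : R -> R -> C) : Prop :=
  exists ft fr frr : R -> R -> C,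
    partials (V := C_R_NormedModule) D f ft fr frr /\
    forall r t : R, D (r, t) ->
      let z : C := f r t in
      let m : R := Cmod z ^ 2 in
      let k : R := 2 * INR n - 1 in
      (ft r t =
        (RtoC alpha + Ci * RtoC beta) *
        (frr r t
         - RtoC 2 * Cconj z * (fr r t * fr r t) / RtoC (1 + m)
         + RtoC (k / r) * fr r t
         - RtoC (k / r ^ 2) * z
         + RtoC (1 / r ^ 2) * (RtoC (2 * m) * z / RtoC (1 + m))))%C.

(* Main.v *)
(* The derivatives of f are those of u pushed forward by the differential of the
   stereographic projection, plus a second-order term for f_rr. Differentiating
   |u| = 1 gives u.u_t = u.u_r = 0 and u.u_rr = -|u_r|^2, and with these
   relations the differential sends P F, where F is the bracket of the first
   equation, to the bracket of the second, and u x F to i times that. Both sides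
   of the first equation are tangent to the sphere, where the differential is
   injective, so the two equations are equivalent pointwise. *)

Require Import Defs.
From Stdlib Require Import Reals Lra.
From Coquelicot Require Import Coquelicot.
(* [c1] is also a projection of Stdlib's [C1_fun]. *)
Import Defs.

(** * Derivatives of vector-valued and complex-valued functions *)

Lemma R3_ext (v w : R3) : c1 v = c1 w -> c2 v = c2 w -> c3 v = c3 w -> v = w.
Proof.
  destruct v as [[v1 v2] v3], w as [[w1 w2] w3]; unfold c1, c2, c3; simpl.
  congruence.
Qed.

Ltac coords :=
  unfold tproj, dot, cross, e3, vec, c1, c2, c3 in *;
  repeat (progress (cbv delta [minus plus opp scal mult]; simpl)).

(** A bounded linear map is its own differential. It is applied to the component projections of [R3]
    and [C]. *)
Lemma is_derive_linear_comp {V W : NormedModule R_AbsRing} (L : V -> W)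
    (f : R -> V) (x : R) (l : V) :
  is_linear L -> is_derive f x l -> is_derive (fun y => L (f y)) x (L l).
Proof.
  intros HL Hf.
  apply filterdiff_ext_lin with (fun y : R => L (scal y l)).
  - apply (filterdiff_comp' f L x (fun y : R => scal y l) L); [exact Hf|].
    now apply filterdiff_linear.
  - intros y; exact (linear_scal L HL y l).
Qed.

Lemma is_derive_pair {V W : NormedModule R_AbsRing} (f : R -> V) (g : R -> W)
    (x : R) (lf : V) (lg : W) :
  is_derive f x lf -> is_derive g x lg ->
  is_derive (V := prod_NormedModule R_AbsRing V W)
    (fun y => (f y, g y)) x (lf, lg).
Proof.
  intros Hf Hg.
  apply (filterdiff_comp'_2 f g
    (fun a b => (a, b) : prod_NormedModule R_AbsRing V W) x
    (fun y : R => scal y lf) (fun y : R => scal y lg) (fun a b => (a, b)) Hf Hg).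
  apply (filterdiff_linear (fun t : prod_NormedModule R_AbsRing V W =>
    (fst t, snd t) : prod_NormedModule R_AbsRing V W)).
  apply is_linear_prod; [apply is_linear_fst | apply is_linear_snd].
Qed.

Lemma is_derive_C_unique (f : R -> C) (x : R) (l1 l2 : C) :
  is_derive (V := C_R_NormedModule) f x l1 ->
  is_derive (V := C_R_NormedModule) f x l2 -> l1 = l2.
Proof.
  assert (Hfst : is_linear (U := C_R_NormedModule) (V := R_NormedModule) fst)
    by apply (is_linear_fst (U := R_NormedModule) (V := R_NormedModule)).
  assert (Hsnd : is_linear (U := C_R_NormedModule) (V := R_NormedModule) snd)
    by apply (is_linear_snd (U := R_NormedModule) (V := R_NormedModule)).
  intros H1 H2; apply injective_projections.
  - transitivity (Derive (fun y => fst (f y)) x); [symmetry|];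
      apply is_derive_unique.
    + now apply (is_derive_linear_comp fst f x l1).
    + now apply (is_derive_linear_comp fst f x l2).
  - transitivity (Derive (fun y => snd (f y)) x); [symmetry|];
      apply is_derive_unique.
    + now apply (is_derive_linear_comp snd f x l1).
    + now apply (is_derive_linear_comp snd f x l2).
Qed.

Lemma is_derive_coords (w : R -> R3) (x : R) (l : R3) :
  is_derive w x l ->
  is_derive (fun y => c1 (w y)) x (c1 l) /\
  is_derive (fun y => c2 (w y)) x (c2 l) /\
  is_derive (fun y => c3 (w y)) x (c3 l).
Proof.
  intros Hw.
  assert (H12 := is_derive_linear_comp fst w x l
    (is_linear_fst (U := prod_NormedModule R_AbsRing R_NormedModule R_NormedModule)
       (V := R_NormedModule)) Hw).
  split; [|split].
  - exact (is_derive_linear_comp fst _ x _ is_linear_fst H12).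
  - exact (is_derive_linear_comp snd _ x _ is_linear_snd H12).
  - exact (is_derive_linear_comp snd w x l
      (is_linear_snd (U := prod_NormedModule R_AbsRing R_NormedModule R_NormedModule)
       (V := R_NormedModule)) Hw).
Qed.

Lemma is_derive_add_const (g : R -> R) (k x l : R) :
  is_derive g x l -> is_derive (fun y => k + g y) x l.
Proof.
  intros Hg; rewrite <- (Rplus_0_l l).
  apply (is_derive_plus (V := R_NormedModule) (fun _ => k)); [|exact Hg].
  apply (is_derive_const (V := R_NormedModule)).
Qed.

Lemma is_derive_dot (v w : R -> R3) (x : R) (v' w' : R3) :
  is_derive v x v' -> is_derive w x w' ->
  is_derive (fun y => dot (v y) (w y)) x (dot v' (w x) + dot (v x) w').
Proof.
  intros Hv Hw.
  destruct (is_derive_coords v x v' Hv) as (Hv1 & Hv2 & Hv3).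
  destruct (is_derive_coords w x w' Hw) as (Hw1 & Hw2 & Hw3).
  unfold dot.
  (* [l] is left open for the product rule to fill in; [ring] then compares it with the stated
     value. *)
  evar (l : R); replace (_ + _) with l; [unfold l|].
  - apply (is_derive_plus (V := R_NormedModule));
      [apply (is_derive_plus (V := R_NormedModule))|];
      apply Derive.is_derive_mult; eassumption.
  - unfold l, plus; simpl; ring.
Qed.

(** * Consequences of the openness of [D] and of the constraint |u| = 1 *)

Lemma locally_slice_r (D : R * R -> Prop) (r t : R) :
  open D -> D (r, t) -> locally r (fun x => D (x, t)).
Proof.
  intros HD Hrt.
  apply (locally_2d_1d_const_y (fun x s => D (x, s))), locally_2d_locally.
  apply filter_imp with D; [now intros [x s]|exact (HD _ Hrt)].
Qed.

Lemma locally_slice_t (D : R * R -> Prop) (r t : R) :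
  open D -> D (r, t) -> locally t (fun s => D (r, s)).
Proof.
  intros HD Hrt.
  apply (locally_2d_1d_const_x (fun x s => D (x, s))), locally_2d_locally.
  apply filter_imp with D; [now intros [x s]|exact (HD _ Hrt)].
Qed.

Lemma is_derive_locally_const (g : R -> R) (x k l : R) :
  locally x (fun y => g y = k) -> is_derive g x l -> l = 0.
Proof.
  intros Hg Hl.
  rewrite <- (is_derive_unique g x l Hl).
  apply is_derive_unique, (is_derive_ext_loc (fun _ => k)).
  - apply filter_imp with (2 := Hg); intros y Hy; now symmetry.
  - apply (is_derive_const (V := R_NormedModule) k x).
Qed.

(** [frr] and [grr] differentiate [fr] and [gr], which are known to agree only on [D]. As [D] is
    open, they agree near [r] at fixed [t], and this suffices. *)
Lemma partials_C_unique (D : R * R -> Prop) (f ft fr frr gt gr grr : R -> R -> C) :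
  open D ->
  partials (V := C_R_NormedModule) D f ft fr frr ->
  partials (V := C_R_NormedModule) D f gt gr grr ->
  forall r t, D (r, t) ->
  ft r t = gt r t /\ fr r t = gr r t /\ frr r t = grr r t.
Proof.
  intros HD Hf Hg r t Hrt.
  assert (Hr : forall x s, D (x, s) -> fr x s = gr x s).
  { intros x s Hx.
    exact (is_derive_C_unique _ _ _ _ (proj1 (proj2 (Hf x s Hx)))
      (proj1 (proj2 (Hg x s Hx)))). }
  split; [|split; [now apply Hr|]].
  - exact (is_derive_C_unique _ _ _ _ (proj1 (Hf r t Hrt)) (proj1 (Hg r t Hrt))).
  - apply (is_derive_C_unique (fun x => gr x t) r);
      [|exact (proj2 (proj2 (Hg r t Hrt)))].
    apply is_derive_ext_loc with (fun x => fr x t);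
      [|exact (proj2 (proj2 (Hf r t Hrt)))].
    apply filter_imp with (2 := locally_slice_r D r t HD Hrt).
    intros x Hx; now apply Hr.
Qed.

Lemma partials_sphere (D : R * R -> Prop) (u ut ur urr : R -> R -> R3) :
  open D -> (forall r t, D (r, t) -> on_sphere (u r t)) ->
  partials D u ut ur urr ->
  forall r t, D (r, t) ->
  dot (u r t) (ut r t) = 0 /\ dot (u r t) (ur r t) = 0 /\
  dot (u r t) (urr r t) = - dot (ur r t) (ur r t).
Proof.
  intros HD Hs Hu.
  assert (comm : forall v w, dot v w = dot w v) by (intros; unfold dot; ring).
  (* This is proved on all of [D] first, because the third relation comes from differentiating it in
     [r]. *)
  assert (Hr : forall r t, D (r, t) -> dot (u r t) (ur r t) = 0).
  { intros r t Hrt; destruct (Hu r t Hrt) as (_ & H & _).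
    assert (E := is_derive_locally_const _ r 1 _
      (filter_imp _ _ (fun x => Hs x t) (locally_slice_r D r t HD Hrt))
      (is_derive_dot _ _ _ _ _ H H)).
    rewrite (comm (ur r t)) in E; lra. }
  intros r t Hrt; destruct (Hu r t Hrt) as (Ht & H & Hrr).
  split; [|split; [now apply Hr|]].
  - assert (E := is_derive_locally_const _ t 1 _
      (filter_imp _ _ (fun s => Hs r s) (locally_slice_t D r t HD Hrt))
      (is_derive_dot _ _ _ _ _ Ht Ht)).
    rewrite (comm (ut r t)) in E; lra.
  - assert (E := is_derive_locally_const _ r 0 _
      (filter_imp _ _ (fun x => Hr x t) (locally_slice_r D r t HD Hrt))
      (is_derive_dot _ _ _ _ _ H Hrr)).
    lra.
Qed.

(** * Stereographic projection and its derivatives along curves *)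

Lemma sphere_south_pole (v : R3) :
  on_sphere v -> v <> opp e3 -> 1 + c3 v <> 0.
Proof.
  intros Hs Hv Hd; apply Hv.
  assert (H3 : c3 v = -1) by lra.
  unfold on_sphere, dot in Hs; rewrite H3 in Hs.
  apply R3_ext.
  - change (c1 (opp e3)) with (- 0); nra.
  - change (c2 (opp e3)) with (- 0); nra.
  - exact H3.
Qed.

Lemma stereo_pair (v : R3) :
  1 + c3 v <> 0 -> stereo v = (c1 v / (1 + c3 v), c2 v / (1 + c3 v)).
Proof.
  intros Hd; unfold stereo, Cdiv; rewrite <- RtoC_inv by exact Hd.
  apply injective_projections; simpl; field; exact Hd.
Qed.

(* The quotient rule applied to [stereo_pair]. *)
Definition dstereo (u w : R3) : C :=
  ((c1 w * (1 + c3 u) - c1 u * c3 w) / (1 + c3 u) ^ 2,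
   (c2 w * (1 + c3 u) - c2 u * c3 w) / (1 + c3 u) ^ 2).

(* Second derivative of [stereo] along a curve with position [u], velocity [v]
   and acceleration [w]. *)
Definition d2stereo (u v w : R3) : C :=
  (dstereo u w - RtoC (2 * c3 v / (1 + c3 u)) * dstereo u v)%C.

Lemma is_derive_stereo (w : R -> R3) (x : R) (w' : R3) :
  1 + c3 (w x) <> 0 -> is_derive w x w' ->
  locally x (fun y => 1 + c3 (w y) <> 0) ->
  is_derive (V := C_R_NormedModule) (fun y => stereo (w y)) x (dstereo (w x) w').
Proof.
  intros Hd Hw Hloc.
  destruct (is_derive_coords w x w' Hw) as (H1 & H2 & H3).
  apply (is_derive_ext_loc (V := C_R_NormedModule)
    (fun y => (c1 (w y) / (1 + c3 (w y)), c2 (w y) / (1 + c3 (w y))))).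
  { apply filter_imp with (2 := Hloc); intros y Hy; now rewrite stereo_pair. }
  apply (is_derive_add_const _ 1) in H3.
  apply (is_derive_pair (V := R_NormedModule) (W := R_NormedModule));
    [apply (is_derive_div (fun y => c1 (w y)) (fun y => 1 + c3 (w y)))
    |apply (is_derive_div (fun y => c2 (w y)) (fun y => 1 + c3 (w y)))]; assumption.
Qed.

Lemma is_derive_dstereo (w v : R -> R3) (x : R) (v' : R3) :
  1 + c3 (w x) <> 0 -> is_derive w x (v x) -> is_derive v x v' ->
  is_derive (V := C_R_NormedModule) (fun y => dstereo (w y) (v y)) x
    (d2stereo (w x) (v x) v').
Proof.
  intros Hd Hw Hv.
  destruct (is_derive_coords w x _ Hw) as (H1 & H2 & H3).
  destruct (is_derive_coords v x _ Hv) as (K1 & K2 & K3).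
  apply (is_derive_add_const _ 1) in H3.
  (* Both components have this form. In the derivative of the numerator the products of first
     derivatives cancel; differentiating the squared denominator gives the subtracted term. *)
  assert (comp : forall (a a' : R -> R) a'',
    is_derive a x (a' x) -> is_derive a' x a'' ->
    is_derive (fun y => (a' y * (1 + c3 (w y)) - a y * c3 (v y)) / (1 + c3 (w y)) ^ 2) x
      ((a'' * (1 + c3 (w x)) - a x * c3 v') / (1 + c3 (w x)) ^ 2
       - 2 * c3 (v x) / (1 + c3 (w x))
         * ((a' x * (1 + c3 (w x)) - a x * c3 (v x)) / (1 + c3 (w x)) ^ 2))).
  { intros a a' a'' Ha Ha'.
    evar (l : R); replace (_ - _) with l; [unfold l|].
    - apply is_derive_div.
      + apply (is_derive_minus (V := R_NormedModule));
          apply Derive.is_derive_mult; eassumption.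
      + apply is_derive_pow, H3.
      + now apply pow_nonzero.
    - unfold l, minus, plus, opp; simpl; field; exact Hd. }
  replace (d2stereo (w x) (v x) v') with
    ((c1 v' * (1 + c3 (w x)) - c1 (w x) * c3 v') / (1 + c3 (w x)) ^ 2
       - 2 * c3 (v x) / (1 + c3 (w x)) * fst (dstereo (w x) (v x)),
     (c2 v' * (1 + c3 (w x)) - c2 (w x) * c3 v') / (1 + c3 (w x)) ^ 2
       - 2 * c3 (v x) / (1 + c3 (w x)) * snd (dstereo (w x) (v x))).
  - apply (is_derive_pair (V := R_NormedModule) (W := R_NormedModule)).
    + exact (comp (fun y => c1 (w y)) (fun y => c1 (v y)) _ H1 K1).
    + exact (comp (fun y => c2 (w y)) (fun y => c2 (v y)) _ H2 K2).
  - apply injective_projections; simpl; ring.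
Qed.

Lemma partials_stereo (D : R * R -> Prop) (u ut ur urr : R -> R -> R3) :
  open D -> (forall r t, D (r, t) -> 1 + c3 (u r t) <> 0) ->
  partials D u ut ur urr ->
  partials (V := C_R_NormedModule) D (fun r t => stereo (u r t))
    (fun r t => dstereo (u r t) (ut r t))
    (fun r t => dstereo (u r t) (ur r t))
    (fun r t => d2stereo (u r t) (ur r t) (urr r t)).
Proof.
  intros HD Hd Hu r t Hrt.
  destruct (Hu r t Hrt) as (Ht & Hr & Hrr).
  split; [|split].
  - apply (is_derive_stereo (fun s => u r s)); [now apply Hd|exact Ht|].
    exact (filter_imp _ _ (fun s => Hd r s) (locally_slice_t D r t HD Hrt)).
  - apply (is_derive_stereo (fun x => u x t)); [now apply Hd|exact Hr|].
    exact (filter_imp _ _ (fun x => Hd x t) (locally_slice_r D r t HD Hrt)).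
  - apply (is_derive_dstereo (fun x => u x t) (fun x => ur x t)); auto.
Qed.

(** * Algebra of the differential on the sphere *)

Lemma dstereo_lin (u v w : R3) (a b : R) :
  1 + c3 u <> 0 ->
  dstereo u (plus (scal a v) (scal b w)) =
  (RtoC a * dstereo u v + RtoC b * dstereo u w)%C.
Proof.
  intros Hd; destruct u as [[u1 u2] u3], v as [[v1 v2] v3], w as [[w1 w2] w3].
  unfold dstereo; coords.
  apply injective_projections; simpl; field; exact Hd.
Qed.

(* A vector is recovered from its image under the differential of [stereo] and
   its normal component, so the differential is injective on tangent vectors. *)
Lemma dstereo_decomp (u w : R3) :
  on_sphere u -> 1 + c3 u <> 0 ->
  let p := fst (dstereo u w) in
  let q := snd (dstereo u w) in
  let w3 := dot u w - (1 + c3 u) * (c1 u * p + c2 u * q) in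
  w = vec ((1 + c3 u) * p + c1 u / (1 + c3 u) * w3)
          ((1 + c3 u) * q + c2 u / (1 + c3 u) * w3) w3.
Proof.
  intros Hs Hd p q w3.
  assert (E : w3 = c3 w).
  { unfold on_sphere in Hs.
    unfold w3, p, q, dstereo; simpl fst; simpl snd.
    (* The excess of [w3] over [c3 w] is a multiple of |u|^2 - 1, which vanishes on the sphere. *)
    transitivity (c3 w + c3 w / (1 + c3 u) * (dot u u - 1)).
    - unfold dot; field; exact Hd.
    - rewrite Hs; ring. }
  rewrite E; unfold p, q, dstereo; simpl fst; simpl snd.
  apply R3_ext; coords; [field; exact Hd|field; exact Hd|reflexivity].
Qed.

Lemma dstereo_inj (u v w : R3) :
  on_sphere u -> 1 + c3 u <> 0 -> dot u v = dot u w ->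
  dstereo u v = dstereo u w -> v = w.
Proof.
  intros Hs Hd Hvw E.
  rewrite (dstereo_decomp u v Hs Hd), (dstereo_decomp u w Hs Hd).
  now rewrite Hvw, E.
Qed.

Lemma dot_tproj (u w : R3) : on_sphere u -> dot u (tproj u w) = 0.
Proof.
  intros Hs; unfold on_sphere in Hs.
  replace (dot u (tproj u w)) with (dot u w - dot u w * dot u u).
  - rewrite Hs; ring.
  - destruct u as [[u1 u2] u3], w as [[w1 w2] w3].
    coords; ring.
Qed.

Lemma dot_cross (u w : R3) : dot u (cross u w) = 0.
Proof. coords; ring. Qed.

Lemma dot_lin (u v w : R3) (a b : R) :
  dot u (plus (scal a v) (scal b w)) = a * dot u v + b * dot u w.
Proof.
  destruct u as [[u1 u2] u3], v as [[v1 v2] v3], w as [[w1 w2] w3].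
  coords; ring.
Qed.

(** The witnesses are the real and imaginary parts of [stereo u]. This parametrization builds in |u|
    = 1, so identities on the sphere become identities of rational functions, within reach of
    [field]. *)
Lemma sphere_stereo_inv (u : R3) :
  on_sphere u -> 1 + c3 u <> 0 ->
  exists p q : R,
  u = vec (2 * p / (1 + (p ^ 2 + q ^ 2))) (2 * q / (1 + (p ^ 2 + q ^ 2)))
          ((1 - (p ^ 2 + q ^ 2)) / (1 + (p ^ 2 + q ^ 2))).
Proof.
  intros Hs Hd.
  exists (c1 u / (1 + c3 u)), (c2 u / (1 + c3 u)).
  unfold on_sphere, dot in Hs.
  assert (Hm : 1 + ((c1 u / (1 + c3 u)) ^ 2 + (c2 u / (1 + c3 u)) ^ 2)
               = 2 / (1 + c3 u)).
  (* With denominators cleared, the left side is (1 + u_3)^2 + u_1^2 + u_2^2, which equals 2 (1 +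
     u_3) on the sphere. *)
  { apply Rmult_eq_reg_r with ((1 + c3 u) ^ 2); [|now apply pow_nonzero].
    transitivity ((1 + c3 u) ^ 2 + (c1 u * c1 u + c2 u * c2 u + c3 u * c3 u)
                  - c3 u ^ 2); [field; exact Hd|].
    rewrite Hs; field; exact Hd. }
  apply R3_ext.
  - rewrite Hm; unfold vec, c1 at 2; simpl; field; exact Hd.
  - rewrite Hm; unfold vec, c2 at 2; simpl; field; exact Hd.
  - rewrite Hm; unfold vec, c3 at 2; simpl fst; simpl snd.
    replace (_ + _) with (2 / (1 + c3 u) - 1) by lra; field; exact Hd.
Qed.

(* Stereographic projection is conformal and, from this pole, orientation
   preserving, so the rotation [cross u] of the tangent plane becomes
   multiplication by [i]. *)
Lemma dstereo_cross (u w : R3) :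
  on_sphere u -> 1 + c3 u <> 0 ->
  dstereo u (cross u w) = (Ci * dstereo u (tproj u w))%C.
Proof.
  intros Hs Hd.
  destruct (sphere_stereo_inv u Hs Hd) as (p & q & ->).
  assert (Hm : 1 + (p ^ 2 + q ^ 2) <> 0) by nra.
  destruct w as [[w1 w2] w3].
  unfold dstereo; coords.
  apply injective_projections; simpl; field; nra.
Qed.

(** * The brackets of the two equations *)

(** Here [z], [z1], [z2] stand for f, f_r, f_rr and [k] for 2n - 1. The term with [Cconj z] is the
    Christoffel correction of the round metric in this coordinate. *)
Definition stereo_tension (k r : R) (z z1 z2 : C) : C :=
  (z2 - RtoC 2 * Cconj z * (z1 * z1) / RtoC (1 + Cmod z ^ 2)
   + RtoC (k / r) * z1
   - RtoC (k / r ^ 2) * z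
   + RtoC (1 / r ^ 2) *
     (RtoC (2 * Cmod z ^ 2) * z / RtoC (1 + Cmod z ^ 2)))%C.

(** The two dot product hypotheses fix the normal components of [v] and [w]. Hence [u], [v], [w] are
    rational in six real parameters, and the claim is a rational identity. *)
Lemma dstereo_tension (k r : R) (u v w : R3) :
  r <> 0 -> on_sphere u -> 1 + c3 u <> 0 ->
  dot u v = 0 -> dot u w = - dot v v ->
  dstereo u (tproj u (plus (plus w (scal (k / r) v))
                           (scal ((k - 1 + c3 u) / r ^ 2) e3))) =
  stereo_tension k r (stereo u) (dstereo u v) (d2stereo u v w).
Proof.
  intros Hr Hs Hd Hv Hw.
  assert (Ev := dstereo_decomp u v Hs Hd).
  assert (Ew := dstereo_decomp u w Hs Hd).
  rewrite Hv in Ev; rewrite Hw in Ew; clear Hv Hw.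
  unfold d2stereo; rewrite stereo_pair by exact Hd.
  destruct (dstereo u v) as [p1 q1], (dstereo u w) as [p2 q2].
  simpl fst in Ev, Ew; simpl snd in Ev, Ew.
  (* [Ew] mentions [v] through |v|^2, so [w] is eliminated before [v]. *)
  rewrite Ew; clear w Ew; rewrite Ev; clear v Ev.
  destruct (sphere_stereo_inv u Hs Hd) as (p & q & ->).
  assert (Hm : 1 + (p ^ 2 + q ^ 2) <> 0) by nra.
  unfold stereo_tension, Cdiv.
  rewrite <- RtoC_inv, Cmod2_alt by (rewrite Cmod2_alt; simpl; nra).
  unfold dstereo; coords.
  apply injective_projections; simpl; field; nra.
Qed.

(** * Pointwise equivalence of the two equations on [D] *)

Theorem proposition2p5 :
  forall (n : nat) (alpha beta : R), (2 <= n)%nat -> 0 <= alpha ->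
  forall D : R * R -> Prop, open D ->
  (forall r t : R, D (r, t) -> 0 < r) ->
  forall u : R -> R -> R3,
  (forall r t : R, D (r, t) -> on_sphere (u r t)) ->
  (forall r t : R, D (r, t) -> u r t <> opp e3) ->
  regular D u ->
  (solves_LL n alpha beta D u <->
   solves_stereo_LL n alpha beta D (fun r t : R => stereo (u r t))).
Proof.
  intros n alpha beta _ _ D HD Hpos u Hs Hpole Hreg.
  assert (Hd : forall r t, D (r, t) -> 1 + c3 (u r t) <> 0).
  { intros r t Hrt; apply sphere_south_pole; auto. }
  (* The differential maps the right side of the first equation to that of the second; both
     directions use this. *)
  assert (rhs : forall ut ur urr, partials D u ut ur urr ->
    forall r t, D (r, t) ->
    let F := plus (plus (urr r t) (scal ((2 * INR n - 1) / r) (ur r t)))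
               (scal ((2 * INR n - 2 + c3 (u r t)) / r ^ 2) e3) in
    dstereo (u r t) (plus (scal alpha (tproj (u r t) F))
                          (scal beta (cross (u r t) F))) =
    ((RtoC alpha + Ci * RtoC beta) *
     stereo_tension (2 * INR n - 1) r (stereo (u r t)) (dstereo (u r t) (ur r t))
       (d2stereo (u r t) (ur r t) (urr r t)))%C).
  { intros ut ur urr Hu r t Hrt F.
    destruct (partials_sphere D u ut ur urr HD Hs Hu r t Hrt) as (_ & Hv & Hw).
    assert (Hr : r <> 0) by (specialize (Hpos r t Hrt); lra).
    rewrite <- (dstereo_tension (2 * INR n - 1) r (u r t) (ur r t) (urr r t));
      auto.
    replace (2 * INR n - 1 - 1) with (2 * INR n - 2) by ring; fold F.
    rewrite dstereo_lin, dstereo_cross by auto; ring. }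
  split.
  - intros (ut & ur & urr & Hu & Heq).
    exists (fun r t => dstereo (u r t) (ut r t)),
      (fun r t => dstereo (u r t) (ur r t)),
      (fun r t => d2stereo (u r t) (ur r t) (urr r t)).
    split; [now apply partials_stereo|].
    intros r t Hrt z m k.
    rewrite (Heq r t Hrt).
    exact (rhs ut ur urr Hu r t Hrt).
  - intros (ft & fr & frr & Hf & Heq).
    destruct Hreg as (ut & ur & urr & Hu).
    exists ut, ur, urr; split; [exact Hu|].
    intros r t Hrt F.
    (* The given derivatives of f are identified on [D] with the pushed-forward derivatives of
       [u]. *)
    destruct (partials_C_unique D _ _ _ _ _ _ _ HD Hf
      (partials_stereo D u ut ur urr HD Hd Hu) r t Hrt) as (Et & Er & Err).
    specialize (Heq r t Hrt); simpl in Heq.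
    rewrite Et, Er, Err in Heq.
    (* Both sides are tangent at [u r t], so it is enough to compare their images. *)
    apply (dstereo_inj (u r t)); auto.
    + rewrite (proj1 (partials_sphere D u ut ur urr HD Hs Hu r t Hrt)).
      rewrite dot_lin, dot_tproj, dot_cross by auto; ring.
    + rewrite Heq; symmetry; exact (rhs ut ur urr Hu r t Hrt).
Qed.
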